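(* Let $\{w_k\}_{k\ge1}$ be any sequence of independent random variables with mean zero and unit variance, let $\tau>0$, and let $\Phi$ be the associated random map. Then a function $u\in H_0^1(\Omega)$ is a weak solution of $Lu=f$ in $\Omega$, $u=0$ on $\partial\Omega$, if and only if it is a $\Phi$-stochastically weak solution of this problem.
   Context: $\Omega\subset\mathbb{R}^d$, $d\ge1$, is a bounded, open, connected set with Lipschitz boundary. $\{\phi_k\}_{k\ge1}$ is an orthonormal basis of $L^2(\Omega)$ of eigenfunctions of the Dirichlet Laplacian, $-\Delta\phi_k=\lambda_k\phi_k$ in $\Omega$, $\phi_k=0$ on $\partial\Omega$, with $0<\lambda_1\le\lambda_2\le\cdots\to\infty$. $H_0^1(\Omega)$ is the usual Sobolev space, with norm $\lVert u\rVert_{H_0^1}^2=\sum_k\lambda_k|\langle u,\phi_k\rangle|^2$, and $H^{-1}(\Omega)$ is its dual. $L$ is a second-order linear elliptic operator with $Lu\in H^{-1}(\Omega)$ for all $u\in H_0^1(\Omega)$, and $f\in H^{-1}(\Omega)$. For $u\in H_0^1(\Omega)$, let $R_u(\varphi)=(Lu-f)(\varphi)$, $\varphi\in H_0^1(\Omega)$. A weak solution of the problem $Lu=f$ in $\Omega$, $u=0$ on $\partial\Omega$ is a $u\in H_0^1(\Omega)$ such that $R_u(\varphi)=0$ for all $\varphi\in H_0^1(\Omega)$. It is assumed that the weak solution is unique. The random variables $w_k$ are defined on a probability space $(\Xi,\mathfrak{F},\mu)$, and $\mu[\cdot]$ is expectation under $\mu$. The random map is $\Phi(\xi,\cdot)=\tau\sum_{k=1}^\infty(1+\lambda_k)^{-1/2}w_k(\xi)\phi_k(\cdot)$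 with partial sums $\Phi^{(n)}(\xi,\cdot)=\tau\sum_{k=1}^n(1+\lambda_k)^{-1/2}w_k(\xi)\phi_k(\cdot)$. Put $\lVert R_u\rVert_\Phi^2:=\lim_{n\to\infty}\mu\big[|R_u(\Phi^{(n)})|^2\big]$ (this limit exists and is finite). A $\Phi$-stochastically weak solution is any $u\in H_0^1(\Omega)$ with $\lVert R_u\rVert_\Phi=0$. *)

(* Defs.v *)
From HB Require Import structures.
From mathcomp Require Import all_boot all_order all_algebra.
From mathcomp Require Import finmap.
From mathcomp Require Import all_classical all_reals all_analysis.
From mathcomp Require Import measurable_realfun.
Import Order.TTheory GRing.Theory Num.Theory.
Import numFieldNormedType.Exports.

Set Implicit Arguments.
Unset Strict Implicit.
Unset Printing Implicit Defensive.

Local Open Scope classical_set_scope.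
Local Open Scope ring_scope.

(** * Lebesgue measure on R^n *)

(* Adding one coordinate: the product of m1 with a measure on n-tuples,
   transported to (n+1)-tuples. *)
Section cons_measure.
Context (R : realType) d (T : measurableType d) (n : nat).
Variable m1 : {sigma_finite_measure set T -> \bar R}.
Variable m : {sigma_finite_measure set (n.-tuple T) -> \bar R}.

Let cons2 (p : T * n.-tuple T) : n.+1.-tuple T := [tuple of p.1 :: p.2].

Definition cons_measure : set (n.+1.-tuple T) -> \bar R :=
  fun A => (m1 \x m)%E (cons2 @^-1` A).

Let mcons2 : measurable_fun setT cons2.
Proof. exact: measurable_cons. Qed.

Let mpre A : measurable A -> measurable (cons2 @^-1` A).
Proof. by move=> mA; rewrite -[X in measurable X]setTI; exact: mcons2. Qed.

Let cm0 : cons_measure set0 = 0%E.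
Proof. by rewrite /cons_measure preimage_set0 measure0. Qed.

Let cm_ge0 A : (0 <= cons_measure A)%E. Proof. exact: measure_ge0. Qed.

Let cm_additive : semi_sigma_additive cons_measure.
Proof.
move=> F mF tF mUF; rewrite /cons_measure preimage_bigcup.
apply: measure_semi_sigma_additive.
- by move=> k; exact: mpre.
- apply/trivIsetP => /= i j _ _ ij; rewrite -preimage_setI.
  by move/trivIsetP : tF => /(_ _ _ _ _ ij) ->//; rewrite preimage_set0.
- by rewrite -preimage_bigcup; exact: mpre.
Qed.

HB.instance Definition _ :=
  isMeasure.Build _ _ _ cons_measure cm0 cm_ge0 cm_additive.

Let cm_sigma_finite : sigma_finite setT cons_measure.
Proof.
have /sigma_finiteP[F [TF ndF Foo]] := sigma_finiteT m1.
have /sigma_finiteP[G [TG ndG Goo]] := sigma_finiteT m.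
exists (fun k => [set t | F k (thead t) /\ G k [tuple of behead t]]).
  apply/esym; rewrite -subTset => t _.
  have : [set: T] (thead t) by []. rewrite TF => -[i _ Fi].
  have : [set: n.-tuple T] [tuple of behead t] by []. rewrite TG => -[j _ Gj].
  exists (maxn i j) => //; split.
  - by move: Fi; exact/subsetPset/ndF/leq_maxl.
  - by move: Gj; exact/subsetPset/ndG/leq_maxr.
move=> k; have [mF Foo'] := Foo k; have [mG Goo'] := Goo k; split.
  apply: (measurableI [set t | F k (thead t)]
                      [set t : n.+1.-tuple T | G k [tuple of behead t]]).
  - by rewrite -[X in measurable X]setTI; exact: measurable_tnth.
  - by rewrite -[X in measurable X]setTI; exact: measurable_behead.
rewrite /cons_measure (_ : _ @^-1` _ = F k `*` G k).
  by rewrite product_measure1E// lte_mul_pinfty// ge0_fin_numE.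
apply/seteqP; split => -[x t] /=; rewrite (_ : [tuple of _] = t)//;
  exact/val_inj.
Qed.

HB.instance Definition _ :=
  Measure_isSigmaFinite.Build _ _ _ cons_measure cm_sigma_finite.

End cons_measure.

Section tuple_measure.
Context (R : realType) d (T : measurableType d).
Variable m1 : {sigma_finite_measure set T -> \bar R}.

Fixpoint tuple_measure n : {sigma_finite_measure set (n.-tuple T) -> \bar R} :=
  if n is n'.+1 then cons_measure m1 (tuple_measure n') else \d_[tuple].

Lemma tuple_measure_box n (A : 'I_n -> set T) :
  (forall i, measurable (A i)) ->
  (tuple_measure n [set t | forall i, A i (tnth t i)]
    = \prod_(i < n) m1 (A i))%E.
Proof.
elim: n A => [|n IH] A mA.
  by rewrite big_ord0 /= diracE mem_set// => -[].
rewrite big_ord_recl -(IH (fun i => A (lift ord0 i)))//.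
rewrite /= /cons_measure -product_measure1E//; last first.
  rewrite (_ : [set t | _] = \bigcap_i ((@tnth _ T)^~ i @^-1` A (lift ord0 i))).
    apply: fin_bigcap_measurable => // i _; rewrite -[X in measurable X]setTI.
    exact: measurable_tnth.
  by apply/seteqP; split => t /= tA i; [move=> _|]; exact: tA.
congr product_measure1; apply/seteqP; split => -[x t] /=.
  move=> xtA; split; first by have := xtA ord0; rewrite tnth0.
  by move=> i; have := xtA (lift ord0 i); rewrite tnthS.
move=> [xA tA] i; have [j ->|->] := unliftP ord0 i; last by rewrite tnth0.
by rewrite tnthS.
Qed.
End tuple_measure.

(* Matrices, in particular row vectors, carry their Borel sigma-algebra. *)
HB.instance Definition _ (R : realType) m n :=
  @isMeasurable.Build (sigma_display (@open 'M[R]_(m, n))) 'M[R]_(m, n)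
    <<s @open 'M[R]_(m, n) >> (@sigma_algebra0 _ setT _)
    (@sigma_algebraC _ _) (@sigma_algebra_bigcup _ setT _).

Section lebesgue_rV.
Context (R : realType) (n : nat).

Let row_of_tuple (t : n.-tuple (measurableTypeR R)) : 'rV[R]_n :=
  \row_i tnth t i.

Let mrow : measurable_fun setT row_of_tuple.
Proof.
apply: (@measurability _ _ _ _ _ _ (@open 'rV[R]_n)) => //.
move=> _ [U oU <-]; rewrite setTI.
pose box (c : n.-tuple rat * nat) : set 'rV[R]_n :=
  [set x | forall i, `|x 0 i - ratr (tnth c.1 i)| < c.2.+1%:R^-1].
have UE : U = \bigcup_(c in [set c | box c `<=` U]) box c.
  apply/seteqP; split => [x Ux|x [c cU]]; last exact: cU.
  have [e /= e0 xeU] := (nbhs_ballP x U).1 (open_nbhs_nbhs (conj oU Ux)).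
  have e20 : 0 < e / 2 by rewrite divr_gt0.
  have [k ke] := ltr_add_invr e20; rewrite add0r in ke.
  have k0 : 0 < k.+1%:R^-1 :> R by rewrite invr_gt0.
  have qP i : {q : rat | `|x 0 i - ratr q| < k.+1%:R^-1}.
    apply/cid; have := @rat_in_itvoo R (x 0 i - k.+1%:R^-1) (x 0 i + k.+1%:R^-1).
    case=> [|q]; first by rewrite ltrBlDr -addrA ltrDl addr_gt0.
    by rewrite in_itv/= -ltr_distl distrC => ?; exists q.
  pose c := ([tuple sval (qP i) | i < n], k).
  exists c; last by move=> i; rewrite tnth_mktuple; exact: (svalP (qP i)).
  move=> y cy; apply: xeU; split=> // i j; rewrite ord1 /ball/=.
  rewrite (splitr e) -(subrKA (ratr (sval (qP j)))).
  rewrite (le_lt_trans (ler_normD _ _))// ltrD//.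
    by rewrite (lt_trans (svalP (qP j))).
  by have := cy j; rewrite tnth_mktuple distrC => /lt_trans; exact.
rewrite UE preimage_bigcup bigcup_mkcond.
apply: countable_bigcupT_measurable => // c; case: ifP => // _.
rewrite (_ : _ @^-1` _ = \bigcap_i ((@tnth _ (measurableTypeR R))^~ i @^-1`
    [set y : measurableTypeR R | `|y - ratr (tnth c.1 i)| < c.2.+1%:R^-1])).
  apply: fin_bigcap_measurable => // i _; rewrite -[X in measurable X]setTI.
  apply: measurable_tnth => //.
  rewrite (_ : [set _ | _] = ball (ratr (tnth c.1 i) : R) c.2.+1%:R^-1).
    exact: measurable_ball.
  by apply/seteqP; split => y /=; rewrite /ball/= distrC.
apply/seteqP; split => t /= bt i; first by move=> _; have := bt i; rewrite mxE.
by rewrite mxE; exact: bt.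
Qed.

Definition lebesgue_rV : set 'rV[R]_n -> \bar R :=
  fun A => tuple_measure lebesgue_measure n (row_of_tuple @^-1` A).

Let mpre A : measurable A -> measurable (row_of_tuple @^-1` A).
Proof. by move=> mA; rewrite -[X in measurable X]setTI; exact: mrow. Qed.

Let leb0 : lebesgue_rV set0 = 0%E.
Proof. by rewrite /lebesgue_rV preimage_set0 measure0. Qed.

Let leb_ge0 A : (0 <= lebesgue_rV A)%E. Proof. exact: measure_ge0. Qed.

Let leb_additive : semi_sigma_additive lebesgue_rV.
Proof.
move=> F mF tF mUF; rewrite /lebesgue_rV preimage_bigcup.
apply: measure_semi_sigma_additive.
- by move=> k; exact: mpre.
- apply/trivIsetP => /= i j _ _ ij; rewrite -preimage_setI.
  by move/trivIsetP : tF => /(_ _ _ _ _ ij) ->//; rewrite preimage_set0.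
- by rewrite -preimage_bigcup; exact: mpre.
Qed.

HB.instance Definition _ :=
  isMeasure.Build _ _ _ lebesgue_rV leb0 leb_ge0 leb_additive.

Lemma lebesgue_rV_box (A : 'I_n -> set (measurableTypeR R)) :
  (forall i, measurable (A i)) ->
  (lebesgue_rV [set x : 'rV[R]_n | forall i, A i (x 0%R i)]
    = \prod_(i < n) lebesgue_measure (A i))%E.
Proof.
move=> mA; rewrite -tuple_measure_box//; congr (tuple_measure _ _ _).
by apply/seteqP; split => t /= + i => /(_ i); rewrite mxE.
Qed.

End lebesgue_rV.

(** * Sobolev spaces on a domain of R^n

   Elements of L^2, H^1_0, ... are represented by functions on R^n, whose values
   outside the domain are irrelevant; equality of such elements is
   equality almost everywhere on the domain. *)
Section sobolev.
Context (R : realType) (n : nat) (Omega : set 'rV[R]_n).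
Notation mu := (@lebesgue_rV R n).
Implicit Types (u v psi : 'rV[R]_n -> R) (g h : 'I_n -> 'rV[R]_n -> R).

(* Near each boundary point, after an orthogonal change of coordinates
   y = x *m Q, Omega is the strict epigraph y_i > gamma(y_1, .., y_n without y_i)
   of a Lipschitz function. *)
Definition lipschitz_boundary :=
  forall x0, (closure Omega `\` interior Omega) x0 ->
  exists (Q : 'M[R]_n) (i : 'I_n) (gamma : 'rV[R]_n.-1 -> R),
    [/\ Q *m Q^T = 1%:M, lipschitz gamma &
        \forall x \near x0,
          Omega x <-> gamma (col' i (x *m Q)) < (x *m Q) 0 i].

Definition lipschitz_domain :=
  [/\ bounded_set Omega, open Omega, connected Omega & lipschitz_boundary].

Definition partial (i : 'I_n) u : 'rV[R]_n -> R := 'D_(delta_mx 0 i) u.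

Definition iter_partial (s : seq 'I_n) u := foldr partial u s.

Definition smooth u := forall s : seq 'I_n,
  continuous (iter_partial s u) /\
  forall x i, derivable (iter_partial s u) x (delta_mx 0 i).

(* C_c^oo(Omega) *)
Definition test_function u :=
  let supp := closure [set x | u x != 0] in
  [/\ smooth u, compact supp & supp `<=` Omega].

Definition L2 u :=
  measurable_fun Omega u /\ mu.-integrable Omega (fun x => (u x ^+ 2)%:E).

Definition L2dot u v : R := \int[mu]_(x in Omega) (u x * v x).

Definition L2cvg (u_ : nat -> 'rV[R]_n -> R) u :=
  (\int[mu]_(x in Omega) ((u_ k x - u x) ^+ 2)%:E)%E @[k --> \oo] --> 0%E.

Definition weak_gradient u g := forall i, L2 (g i) /\
  forall psi, test_function psi ->
    L2dot u (partial i psi) = - L2dot (g i) psi.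

(* The closure of C_c^oo(Omega) in H^1(Omega). *)
Definition H10 u := L2 u /\ exists g, weak_gradient u g /\
  exists psi : nat -> 'rV[R]_n -> R,
    [/\ forall k, test_function (psi k), L2cvg psi u &
        forall i, L2cvg (fun k => partial i (psi k)) (g i)].

Definition orthonormal_basis (phi : nat -> 'rV[R]_n -> R) :=
  [/\ forall k, L2 (phi k),
      forall j k, L2dot (phi j) (phi k) = (j == k)%:R &
      forall u, L2 u ->
        L2cvg (fun N x => \sum_(k < N) L2dot u (phi k) * phi k x) u].

(* -Delta w = lambda w in Omega, w = 0 on the boundary, in the weak sense *)
Definition dirichlet_eigenfunction (lambda : R) w := H10 w /\
  forall g v h, weak_gradient w g -> H10 v -> weak_gradient v h ->
    \sum_(i < n) L2dot (g i) (h i) = lambda * L2dot w v.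

(* Indices start at 0. *)
Definition dirichlet_eigenbasis (lambda : nat -> R)
    (phi : nat -> 'rV[R]_n -> R) :=
  [/\ orthonormal_basis phi,
      forall k, dirichlet_eigenfunction (lambda k) (phi k),
      0 < lambda 0,
      forall j k, (j <= k)%N -> lambda j <= lambda k &
      lambda k @[k --> \oo] --> +oo].

Section dual.
Variables (lambda : nat -> R) (phi : nat -> 'rV[R]_n -> R).

Definition H10norm u : \bar R :=
  sqrte (\sum_(0 <= k <oo) (lambda k * `|L2dot u (phi k)| ^+ 2)%:E)%E.

(* The dual of H^1_0: a functional is given by its values on H^1_0; its values
   at other functions are irrelevant. *)
Definition Hm1 (l : ('rV[R]_n -> R) -> R) :=
  (forall (a : R) u v, H10 u -> H10 v ->
    l (fun x => a * u x + v x) = a * l u + l v) /\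
  exists2 C : R, 0 <= C &
    forall u, H10 u -> (`|l u|%:E <= C%:E * H10norm u)%E.

End dual.

Definition locally_integrable_on u :=
  forall K, compact K -> K `<=` Omega -> mu.-integrable K (EFin \o u).

(* The general second-order linear operator in divergence form
     L u = - sum_i d_i (sum_j a_ij d_j u + p_i u) + sum_i b_i d_i u + c u,
   read in the sense of distributions: all the products are locally integrable,
   and L u acts on test functions by the integrated-by-parts formula. Ellipticity
   only asks for a positive definite matrix a(x) at almost every x; in
   particular uniformly elliptic operators are covered. *)
Definition second_order_elliptic
    (L : ('rV[R]_n -> R) -> ('rV[R]_n -> R) -> R) :=
  exists (a : 'I_n -> 'I_n -> 'rV[R]_n -> R) (p b : 'I_n -> 'rV[R]_n -> R)
         (c : 'rV[R]_n -> R),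
  [/\ [/\ forall i j, measurable_fun Omega (a i j),
          forall i, measurable_fun Omega (p i),
          forall i, measurable_fun Omega (b i) & measurable_fun Omega c],
      {ae mu, forall x, Omega x -> forall xi : 'I_n -> R, (exists i, xi i != 0) ->
        0 < \sum_(i < n) \sum_(j < n) a i j x * xi i * xi j} &
      forall u g, H10 u -> weak_gradient u g ->
        [/\ forall i j, locally_integrable_on (a i j \* g j),
            forall i, locally_integrable_on (p i \* u),
            forall i, locally_integrable_on (b i \* g i),
            locally_integrable_on (c \* u) &
            forall psi, test_function psi ->
              L u psi = \int[mu]_(x in Omega)
                (\sum_(i < n)
                    ((\sum_(j < n) a i j x * g j x) + p i x * u x)
                      * partial i psi x
                 + (\sum_(i < n) b i x * g i x) * psi x
                 + c x * u x * psi x)]].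

Definition residual (L : ('rV[R]_n -> R) -> ('rV[R]_n -> R) -> R)
    (f : ('rV[R]_n -> R) -> R) u v : R := L u v - f v.

Definition weak_solution L f u :=
  H10 u /\ forall v, H10 v -> residual L f u v = 0.

Definition unique_weak_solution L f :=
  forall u1 u2, weak_solution L f u1 -> weak_solution L f u2 ->
    {ae mu, forall x, Omega x -> u1 x = u2 x}.

End sobolev.

(** * Random maps and stochastically weak solutions *)

Definition independent d (Xi : measurableType d) (R : realType)
    (P : probability Xi R) (w : nat -> {RV P >-> R}) :=
  forall (J : {fset nat}) (B : nat -> set R), (forall k, measurable (B k)) ->
    P (\bigcap_(k in [set` J]) (w k @^-1` B k))
      = (\prod_(k <- J) P (w k @^-1` B k))%E.

Section stochastic.
Context (R : realType) (n : nat) (Omega : set 'rV[R]_n).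
Context d (Xi : measurableType d) (P : probability Xi R).
Variables (lambda : nat -> R) (phi : nat -> 'rV[R]_n -> R).
Variables (tau : R) (w : nat -> {RV P >-> R}).

(* Partial sums of the random map Phi. *)
Definition random_map (N : nat) (xi : Xi) : 'rV[R]_n -> R := fun x =>
  tau * \sum_(k < N) (1 + lambda k) `^ (- 2^-1) * w k xi * phi k x.

(* ||l||_Phi *)
Definition stochastic_norm (l : ('rV[R]_n -> R) -> R) : \bar R :=
  sqrte (limn (fun N => 'E_P[fun xi => (`|l (random_map N xi)| ^+ 2)%R]))%E.

Definition stochastically_weak_solution L f (u : 'rV[R]_n -> R) :=
  H10 Omega u /\ stochastic_norm (residual L f u) = 0%E.

End stochastic.

(* Main.v *)
Require Import Defs.
From HB Require Import structures.
From mathcomp Require Import all_boot all_order all_algebra.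
From mathcomp Require Import finmap.
From mathcomp Require Import all_classical all_reals all_analysis.
From mathcomp Require Import measurable_realfun ring lra.
Import Order.TTheory GRing.Theory Num.Theory.
Import numFieldNormedType.Exports.

Set Implicit Arguments.
Unset Strict Implicit.
Unset Printing Implicit Defensive.

Local Open Scope classical_set_scope.
Local Open Scope ring_scope.

(** Write r = L u - f, a bounded linear functional on H^1_0(Omega). Evaluated at
    a partial sum of the random map, it is a combination of the variables w_k
    with weights a_k = tau (1 + lambda_k)^(-1/2) r(phi_k). Independent variables
    of mean zero and unit variance are orthonormal in L^2 of the probability
    space ([independent_orthonormal]), hence the second moment of the N-th
    partial sum is the sum of the a_k^2 over k < N ([expectation_random_map]).
    Its limit vanishes if and only if all a_k do, that is, since tau and the
    1 + lambda_k are positive, if and only if r kills every eigenfunction.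

    It remains to see that r is then zero on all of H^1_0 ([Hm1_eq0_basis]).
    Subtracting from v its N-th Fourier sum leaves r(v) unchanged, so that r(v)
    is bounded by a constant times the norm of the Fourier remainder. The square
    of that norm is the tail of the series of lambda_k <v, phi_k>^2, and this
    series converges: the eigenfunctions are orthogonal for the Dirichlet form
    too, with energies lambda_k, so Bessel's inequality bounds the series by the
    squared L^2 norm of the weak gradient of v ([dirichlet_bessel]).

    Both steps evaluate r at finite combinations of eigenfunctions, and r is
    linear only on H^1_0; the closure of that space under linear combinations
    ([H10_lin]) is therefore proved from its definition by approximating test
    functions. *)

(** * Square-integrable functions over an arbitrary measure *)

Section square_integrable.
Context d (T : measurableType d) (R : realType) (m : {measure set T -> \bar R}).
Variables (D : set T) (mD : measurable D).
Implicit Types u v z : T -> R.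

(** The same notion serves for L^2(Omega), where the measure is Lebesgue measure
    and D is the domain, and for L^2 of the probability space, so that Fourier
    sums of functions and sums of random variables obey the same lemmas. *)
Definition square_integrable u :=
  measurable_fun D u /\ m.-integrable D (fun x => (u x ^+ 2)%:E).

Definition pairing u v : R := \int[m]_(x in D) (u x * v x).

Lemma pairingC u v : pairing u v = pairing v u.
Proof. by apply: eq_Rintegral => x _; rewrite mulrC. Qed.

Lemma pairing_ge0 u : 0 <= pairing u u.
Proof. by apply: Rintegral_ge0 => x _; rewrite -expr2 sqr_ge0. Qed.

Lemma integrable_mul u v : square_integrable u -> square_integrable v ->
  m.-integrable D (fun x => (u x * v x)%:E).
Proof.
move=> [mu iu] [mv iv].
apply: (le_integrable mD _ _ (integrableD mD iu iv)).
  by apply/measurable_EFinP; exact: measurable_funM.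
move=> x _ /=; rewrite lee_fin normrM [leRHS]ger0_norm ?addr_ge0 ?sqr_ge0//.
rewrite -(real_normK (num_real (u x))) -(real_normK (num_real (v x))).
have := mulr_ge0 (normr_ge0 (u x)) (normr_ge0 (v x)).
by have := sqr_ge0 (`|u x| - `|v x|); nra.
Qed.

(** The linearity statements are for a * u + v with the sum and the
    product written pointwise: this is the form in which a functional on the
    Sobolev space is linear, and iterating it gives finite sums. *)
Lemma square_integrable_lin u v a : square_integrable u -> square_integrable v ->
  square_integrable (fun x => a * u x + v x).
Proof.
move=> su sv; have iuv := integrable_mul su sv; case: su sv => [mu iu] [mv iv].
split.
  by apply: measurable_funD => //; apply: measurable_funM.
have := integrableD mD (integrableZl mD (a ^+ 2) iu)
  (integrableD mD (integrableZl mD (2 * a) iuv) iv).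
apply: eq_integrable => // x _ /=.
by rewrite -!EFinM -!EFinD; congr EFin; ring.
Qed.

Lemma pairing_linl a u v z :
  square_integrable u -> square_integrable v -> square_integrable z ->
  pairing (fun x => a * u x + v x) z = a * pairing u z + pairing v z.
Proof.
move=> su sv sz; rewrite /pairing -RintegralZl//; last exact: integrable_mul.
rewrite -RintegralD//; [|exact: (integrableZl mD a (integrable_mul su sz))
  |exact: integrable_mul].
by apply: eq_Rintegral => x _; ring.
Qed.

Lemma pairing_linr a u v z :
  square_integrable u -> square_integrable v -> square_integrable z ->
  pairing z (fun x => a * u x + v x) = a * pairing z u + pairing z v.
Proof.
by move=> su sv sz; rewrite pairingC pairing_linl// !(pairingC z).
Qed.

Lemma pairing_sqr u : square_integrable u ->
  (\int[m]_(x in D) (u x ^+ 2)%:E = (pairing u u)%:E)%E.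
Proof.
by move=> [_ iu]; rewrite /pairing /Rintegral fineK// integrable_fin_num.
Qed.

(** The cross terms cancel in the parallelogram identity for v + a u and
    v - a u, and the second of these two squares is nonnegative. *)
Lemma pairing_lin_le a u v : square_integrable u -> square_integrable v ->
  pairing (fun x => a * u x + v x) (fun x => a * u x + v x) <=
  2 * a ^+ 2 * pairing u u + 2 * pairing v v.
Proof.
move=> su sv.
have sqrE b : pairing (fun x => b * u x + v x) (fun x => b * u x + v x) =
    b ^+ 2 * pairing u u + 2 * b * pairing u v + pairing v v.
  have suv := square_integrable_lin b su sv.
  by rewrite pairing_linl// !pairing_linr// (pairingC v u); ring.
rewrite sqrE; have := pairing_ge0 (fun x => - a * u x + v x).
by rewrite sqrE; nra.
Qed.

Lemma integral_sqr_lin_cvg0 a (p q : nat -> T -> R) :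
  (forall k, square_integrable (p k)) -> (forall k, square_integrable (q k)) ->
  (\int[m]_(x in D) (p k x ^+ 2)%:E)%E @[k --> \oo] --> 0%E ->
  (\int[m]_(x in D) (q k x ^+ 2)%:E)%E @[k --> \oo] --> 0%E ->
  (\int[m]_(x in D) ((a * p k x + q k x) ^+ 2)%:E)%E @[k --> \oo] --> 0%E.
Proof.
move=> sp sq p0 q0.
apply: (@squeeze_cvge _ _ _ _ (cst 0%E) _
  (fun k => (2 * a ^+ 2)%:E * \int[m]_(x in D) (p k x ^+ 2)%:E +
            2%:E * \int[m]_(x in D) (q k x ^+ 2)%:E)%E).
- apply: nearW => k; rewrite integral_ge0/=; last first.
    by move=> x _; rewrite lee_fin sqr_ge0.
  rewrite (pairing_sqr (square_integrable_lin a (sp k) (sq k))).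
  rewrite (pairing_sqr (sp k)) (pairing_sqr (sq k)) -!EFinM -EFinD lee_fin.
  exact: pairing_lin_le.
- exact: cvg_cst.
- rewrite -[X in _ --> X]adde0; apply: cvgeD => //.
    by rewrite -[X in _ --> X](mule0 (2 * a ^+ 2)%:E); exact: cvgeZl.
  by rewrite -[X in _ --> X](mule0 2%:E); exact: cvgeZl.
Qed.

Lemma square_integrable_sum (a : nat -> R) (w : nat -> T -> R) N :
  (forall k, square_integrable (w k)) -> square_integrable (fun x => \sum_(k < N) a k * w k x).
Proof.
move=> sw; elim: N => [|N IH].
  under eq_fun do rewrite big_ord0.
  split; first exact: measurable_cst.
  by under eq_fun do rewrite expr0n/=; exact: integrable0.
under eq_fun do rewrite big_ord_recr/= addrC.
exact: square_integrable_lin.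
Qed.

Lemma pairing_suml (a : nat -> R) (w : nat -> T -> R) N z :
  (forall k, square_integrable (w k)) -> square_integrable z ->
  pairing (fun x => \sum_(k < N) a k * w k x) z = \sum_(k < N) a k * pairing (w k) z.
Proof.
move=> sw sz; elim: N => [|N IH].
  rewrite big_ord0 /pairing; under eq_Rintegral do rewrite big_ord0 mul0r.
  by rewrite /Rintegral integral0.
rewrite big_ord_recr/= -IH addrC -pairing_linl//; last first.
  exact: square_integrable_sum.
by congr pairing; apply/funext => x; rewrite big_ord_recr/= addrC.
Qed.

(** Used for random coefficients: it turns the second moment of a sum of
    uncorrelated normalized variables into the sum of the squared weights. *)
Lemma parseval_sum (a : nat -> R) (w : nat -> T -> R) N :
  (forall k, square_integrable (w k)) -> (forall j k, pairing (w j) (w k) = (j == k)%:R) ->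
  pairing (fun x => \sum_(k < N) a k * w k x) (fun x => \sum_(k < N) a k * w k x)
    = \sum_(k < N) a k ^+ 2.
Proof.
move=> sw ow; rewrite pairing_suml//; last exact: square_integrable_sum.
apply: eq_bigr => k _; rewrite pairingC pairing_suml//.
rewrite (bigD1 k)//= ow eqxx mulr1 big1 ?addr0 ?expr2// => j jk.
by rewrite ow (negPf jk : (nat_of_ord j == k) = false) mulr0.
Qed.

End square_integrable.

(** * The Sobolev space is a linear space *)

Section sobolev_space.
Context (R : realType) (n : nat) (Omega : set 'rV[R]_n).
Hypotheses (Omega_bounded : bounded_set Omega) (Omega_open : open Omega).
Local Notation mu := (@lebesgue_rV R n).
Implicit Types (u v psi : 'rV[R]_n -> R) (g h : 'I_n -> 'rV[R]_n -> R).

Lemma open_measurable_rV (U : set 'rV[R]_n) : open U -> measurable U.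
Proof. by move=> oU; exact: sub_sigma_algebra. Qed.

Lemma continuous_measurable_rV u : continuous u -> measurable_fun setT u.
Proof.
move=> cu; apply: (measurability _ (RGenOpens.measurableE R)) => //.
move=> _ [_ [a [b ->]] <-]; rewrite setTI; apply: open_measurable_rV.
by apply: open_comp => [x _|]; [exact: cu|exact: interval_open].
Qed.

Lemma bounded_sub_box : exists M : R,
  Omega `<=` [set x | forall i, x 0 i \in `[- M, M]].
Proof.
have [M [_ OM]] := Omega_bounded; exists (M + 1) => x Ox i.
rewrite /= in_itv/= -ler_norml.
have /= := OM (M + 1) _ x Ox; rewrite ltrDl => /(_ ltr01); apply: le_trans.
by rewrite [leRHS]mx_normrE; exact: (le_bigmax _ (fun j : 'I_1 * 'I_n => `|x j.1 j.2|) (0, i)).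
Qed.

Lemma bounded_finite_measure : (mu Omega < +oo)%E.
Proof.
have [M OM] := bounded_sub_box.
pose I : set (measurableTypeR R) := [set y | y \in `[- M, M]].
have mI : measurable I by exact: measurable_itv.
pose B := [set x : 'rV[R]_n | forall i, I (x 0 i)].
have mB : measurable B.
  rewrite (_ : B = \bigcap_(i in setT) ((fun x : 'rV[R]_n => x 0 i) @^-1` I)).
    apply: fin_bigcap_measurable => // i _.
    rewrite -[X in measurable X]setTI.
    by apply: continuous_measurable_rV => //; exact: coord_continuous.
  by apply/seteqP; split => x /= Ix i; [move=> _|]; exact: Ix.
apply: (@le_lt_trans _ _ (mu B)).
  by apply: le_measure; rewrite ?inE//; exact: open_measurable_rV.
rewrite (lebesgue_rV_box (fun=> mI)) ltey_eq; apply/orP; left.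
apply: (big_ind (fun x => x \is a fin_num)) => // [x y|i _]; first exact: fin_numM.
have -> : I = `[- M, M]%classic by [].
by rewrite lebesgue_measure_itv/=; case: ifP.
Qed.

(** A bounded domain sits in a closed box, which is compact and has finite
    Lebesgue measure; a continuous function is bounded on the box. This makes
    test functions and their partial derivatives square integrable, which the
    linearity of the integrals that define weak gradients requires. *)
Lemma continuous_bounded_L2 u : continuous u -> L2 Omega u.
Proof.
move=> cu; split.
  by apply: measurable_funTS; exact: continuous_measurable_rV.
apply: measurable_bounded_integrable.
- exact: open_measurable_rV.
- exact: bounded_finite_measure.
- by apply: measurable_funTS; apply: measurable_funX; exact: continuous_measurable_rV.
have [M OM] := bounded_sub_box.
have : compact [set x : 'rV[R]_n | forall i, `[- M, M]%classic (x 0 i)].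
  by apply: (@rV_compact _ _ (fun=> `[- M, M]%classic)) => _; exact: segment_compact.
move=> cB; have : compact ((fun x => u x ^+ 2) @`
    [set x : 'rV[R]_n | forall i, `[- M, M]%classic (x 0 i)]).
  apply: continuous_compact cB; apply: continuous_subspaceT.
  move=> x.
  by apply: continuousM; exact: cu.
move=> /compact_bounded [K [Kreal uK]]; exists K; split=> // K' KK' x Ox.
by apply: (uK K' KK' (u x ^+ 2)); exists x => // i; exact: OM.
Qed.

Lemma partial_lin (a : R) u v i x : derivable u x (delta_mx 0 i) ->
  derivable v x (delta_mx 0 i) ->
  partial i (fun y => a * u y + v y) x = a * partial i u x + partial i v x.
Proof.
by move=> du dv; rewrite /partial (deriveD (derivableZ du) dv) deriveZ.
Qed.

Lemma iter_partial_lin (a : R) u v s : smooth u -> smooth v ->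
  iter_partial s (fun y => a * u y + v y) =
  (fun y => a * iter_partial s u y + iter_partial s v y).
Proof.
move=> su sv; elim: s => //= i s ->; apply/funext => x.
by apply: partial_lin; [exact: (su s).2|exact: (sv s).2].
Qed.

Lemma smooth_lin (a : R) u v : smooth u -> smooth v ->
  smooth (fun y => a * u y + v y).
Proof.
move=> su sv s; rewrite iter_partial_lin//; split => [x|x i].
  apply: (@continuousD _ _ _ (a \*: iter_partial s u)); last exact: (sv s).1.
  by apply: continuousZl_tmp; exact: (su s).1.
apply: (@derivableD _ _ _ (a \*: iter_partial s u)); last exact: (sv s).2.
by apply: derivableZ; exact: (su s).2.
Qed.

(** The support of a combination is a closed part of the union of two compact
    supports. *)
Lemma test_function_lin (a : R) u v : test_function Omega u ->
  test_function Omega v -> test_function Omega (fun y => a * u y + v y).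
Proof.
move=> [su cu uO] [sv cv vO].
have sub : closure [set x | a * u x + v x != 0] `<=`
    closure [set x | u x != 0] `|` closure [set x | v x != 0].
  rewrite -closureU; apply: closureS => x /=; apply: contra_neqP => /not_orP.
  by move=> [/negP/negPn/eqP -> /negP/negPn/eqP ->]; rewrite mulr0 addr0.
split; first exact: smooth_lin.
- by apply: (subclosed_compact _ (compactU cu cv)) => //; exact: closed_closure.
- by apply: subset_trans sub _; rewrite subUset; split.
Qed.

Lemma test_function_partial_L2 psi i : test_function Omega psi ->
  L2 Omega (partial i psi).
Proof. by move=> [spsi _ _]; apply: continuous_bounded_L2; exact: (spsi [:: i]).1. Qed.

Lemma test_function_L2 psi : test_function Omega psi -> L2 Omega psi.
Proof. by move=> [spsi _ _]; apply: continuous_bounded_L2; exact: (spsi [::]).1. Qed.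

Let mO : measurable Omega := open_measurable_rV Omega_open.

Lemma L2_lin (a : R) u v : L2 Omega u -> L2 Omega v ->
  L2 Omega (fun y => a * u y + v y).
Proof. exact: square_integrable_lin. Qed.

Lemma L2dotC u v : L2dot Omega u v = L2dot Omega v u.
Proof. exact: pairingC. Qed.

Lemma L2dot_linl (a : R) u v psi : L2 Omega u -> L2 Omega v -> L2 Omega psi ->
  L2dot Omega (fun y => a * u y + v y) psi = a * L2dot Omega u psi + L2dot Omega v psi.
Proof. exact: pairing_linl. Qed.

Lemma L2dot_linr (a : R) u v psi : L2 Omega u -> L2 Omega v -> L2 Omega psi ->
  L2dot Omega psi (fun y => a * u y + v y) = a * L2dot Omega psi u + L2dot Omega psi v.
Proof. exact: pairing_linr. Qed.

Lemma weak_gradient_lin (a : R) u v g h : L2 Omega u -> L2 Omega v ->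
  weak_gradient Omega u g -> weak_gradient Omega v h ->
  weak_gradient Omega (fun y => a * u y + v y) (fun i y => a * g i y + h i y).
Proof.
move=> Lu Lv ug vh i; have [Lg gE] := ug i; have [Lh hE] := vh i; split.
  exact: square_integrable_lin.
move=> psi tpsi; have Lp := test_function_L2 tpsi.
have Lpi := test_function_partial_L2 i tpsi.
by rewrite !L2dot_linl// gE// hE//; ring.
Qed.

Lemma L2cvg_lin (a : R) (p q : nat -> 'rV[R]_n -> R) u v :
  L2 Omega u -> L2 Omega v -> (forall k, L2 Omega (p k)) ->
  (forall k, L2 Omega (q k)) -> L2cvg Omega p u -> L2cvg Omega q v ->
  L2cvg Omega (fun k y => a * p k y + q k y) (fun y => a * u y + v y).
Proof.
move=> Lu Lv Lp Lq pu qv.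
have LB s t : L2 Omega s -> L2 Omega t -> L2 Omega (fun x => s x - t x).
  move=> Ls Lt; have := square_integrable_lin mO (-1) Lt Ls.
  by under eq_fun do rewrite mulN1r addrC.
have := integral_sqr_lin_cvg0 mO a (fun k => LB _ _ (Lp k) Lu) (fun k => LB _ _ (Lq k) Lv) pu qv.
apply: cvg_trans; apply: near_eq_cvg; apply: nearW => k.
by apply: eq_integral => x _; congr EFin; ring.
Qed.

(** Approximating test functions and weak gradients are combined with the same
    coefficients as the functions. *)
Lemma H10_lin (a : R) u v : H10 Omega u -> H10 Omega v ->
  H10 Omega (fun y => a * u y + v y).
Proof.
move=> [Lu [g [ug [p [tp pu pg]]]]] [Lv [h [vh [q [tq qv qh]]]]].
split; first exact: square_integrable_lin.
exists (fun i y => a * g i y + h i y); split; first exact: weak_gradient_lin.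
exists (fun k y => a * p k y + q k y); split.
- by move=> k; exact: test_function_lin.
- by apply: L2cvg_lin => // k; exact: test_function_L2.
move=> i; rewrite /L2cvg.
have := @L2cvg_lin a _ _ _ _ (ug i).1 (vh i).1
  (fun k => test_function_partial_L2 i (tp k))
  (fun k => test_function_partial_L2 i (tq k)) (pg i) (qh i).
apply: cvg_trans; apply: near_eq_cvg; apply: nearW => k.
apply: eq_integral => x _; rewrite partial_lin//.
  by have [spk _ _] := tp k; exact: (spk [::]).2.
by have [sqk _ _] := tq k; exact: (sqk [::]).2.
Qed.

Lemma H10_sum (a : nat -> R) (phi : nat -> 'rV[R]_n -> R) N :
  (forall k, H10 Omega (phi k)) -> H10 Omega (fun x => \sum_(k < N) a k * phi k x).
Proof.
move=> Hphi; elim: N => [|N IH].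
  (* The zero function is reached as a combination of phi 0 with itself. *)
  have := H10_lin (-1) (Hphi 0) (Hphi 0); congr H10; apply/funext => x.
  by rewrite big_ord0; ring.
under eq_fun do rewrite big_ord_recr/= addrC.
exact: H10_lin.
Qed.

End sobolev_space.

(** * Fourier remainders in the Dirichlet eigenbasis *)

Section eigenbasis.
Context (R : realType) (n : nat) (Omega : set 'rV[R]_n).
Hypotheses (Omega_bounded : bounded_set Omega) (Omega_open : open Omega).
Context (lambda : nat -> R) (phi : nat -> 'rV[R]_n -> R).
Hypothesis eigen : dirichlet_eigenbasis Omega lambda phi.
Local Notation energy h := (\sum_(i < n) L2dot Omega (h i) (h i)).

Lemma eigenvalue_ge0 k : 0 <= lambda k.
Proof.
by case: eigen => _ _ l0 lmono _; apply: le_trans (ltW l0) (lmono _ _ _).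
Qed.

Lemma eigenfunction_H10 k : H10 Omega (phi k).
Proof. by case: eigen => _ /(_ k)[]. Qed.

Definition fourier_remainder (v : 'rV[R]_n -> R) N : 'rV[R]_n -> R :=
  fun x => v x - \sum_(k < N) L2dot Omega v (phi k) * phi k x.

Lemma fourier_remainder0 v : fourier_remainder v 0 = v.
Proof. by apply/funext => x; rewrite /fourier_remainder big_ord0 subr0. Qed.

Lemma fourier_remainderS v N : fourier_remainder v N.+1 =
  (fun x => - L2dot Omega v (phi N) * phi N x + fourier_remainder v N x).
Proof.
by apply/funext => x; rewrite /fourier_remainder big_ord_recr/=; ring.
Qed.

Lemma fourier_remainder_H10 v N : H10 Omega v -> H10 Omega (fourier_remainder v N).
Proof.
move=> Hv; elim: N => [|N IH]; first by rewrite fourier_remainder0.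
by rewrite fourier_remainderS; apply: H10_lin => //; exact: eigenfunction_H10.
Qed.

Lemma fourier_remainder_coef v N j : H10 Omega v ->
  L2dot Omega (fourier_remainder v N) (phi j) =
  if (j < N)%N then 0 else L2dot Omega v (phi j).
Proof.
move=> Hv; have [[L2phi ophi _] _ _ _ _] := eigen.
elim: N => [|N IH]; first by rewrite fourier_remainder0.
rewrite fourier_remainderS L2dot_linl//; last exact: (fourier_remainder_H10 N Hv).1.
rewrite ophi IH ltnS eq_sym.
have [->|jN] := eqVneq j N; first by rewrite ltnn leqnn mulr1 addNr.
by rewrite mulr0 add0r (leq_eqVlt j N) (negPf jN).
Qed.

(** Pythagoras for the Dirichlet energy. Going from N to N + 1 subtracts
    c phi_N, where c is the N-th coefficient of both v and the N-th remainder.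
    Testing the weak eigenvalue equation of phi_N with phi_N itself and with
    the remainder shows that phi_N has energy lambda_N and that its gradient
    pairs with that of the remainder to lambda_N c; so the energy drops by
    lambda_N c^2. *)
Lemma fourier_remainder_energy v h N : H10 Omega v -> weak_gradient Omega v h ->
  exists hN, weak_gradient Omega (fourier_remainder v N) hN /\
    energy hN = energy h - \sum_(k < N) lambda k * L2dot Omega v (phi k) ^+ 2.
Proof.
move=> Hv vh; have [[L2phi ophi _] eig _ _ _] := eigen.
elim: N => [|N [hN [vhN hNE]]].
  by exists h; rewrite fourier_remainder0 big_ord0 subr0.
have [[_ [g [phig _]]] gE] := eig N; set c := L2dot Omega v (phi N).
have HN := fourier_remainder_H10 N Hv.
exists (fun i y => - c * g i y + hN i y); split.
  rewrite fourier_remainderS; apply: weak_gradient_lin => //; exact: HN.1.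
have gg := gE _ _ _ phig (eigenfunction_H10 N) phig.
have gh := gE _ _ _ phig HN vhN.
rewrite ophi eqxx mulr1 in gg.
rewrite (L2dotC Omega (phi N)) fourier_remainder_coef// ltnn in gh.
rewrite big_ord_recr/= -/c opprD addrA -hNE.
transitivity (c ^+ 2 * energy g - 2 * c * (\sum_(i < n) L2dot Omega (g i) (hN i))
    + energy hN).
  rewrite !mulr_sumr -sumrB -big_split/=; apply: eq_bigr => i _.
  have Lg := (phig i).1; have Lh := (vhN i).1.
  rewrite L2dot_linl//; last exact: L2_lin.
  by rewrite !L2dot_linr// (L2dotC Omega (hN i) (g i)); ring.
by rewrite gg gh -/c; ring.
Qed.

(** The energy of a remainder is nonnegative. *)
Lemma dirichlet_bessel v h N : H10 Omega v -> weak_gradient Omega v h ->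
  \sum_(k < N) lambda k * L2dot Omega v (phi k) ^+ 2 <= energy h.
Proof.
move=> Hv vh; have [hN [_ hNE]] := fourier_remainder_energy N Hv vh.
rewrite -subr_ge0 -hNE; apply: sumr_ge0 => i _; exact: pairing_ge0.
Qed.

(** The Fourier coefficients of the N-th remainder are those of v from N on, and
    zero below; so its squared norm is the tail of a series that Bessel's
    inequality makes convergent. *)
Lemma fourier_remainder_cvg v (e : R) : H10 Omega v -> 0 < e ->
  exists N, (H10norm Omega lambda phi (fourier_remainder v N) <= e%:E)%E.
Proof.
move=> Hv e0; have [_ [h [vh _]]] := Hv.
pose a k : \bar R := (lambda k * L2dot Omega v (phi k) ^+ 2)%:E.
have a0 k : (0 <= a k)%E.
  by rewrite lee_fin mulr_ge0 ?sqr_ge0// eigenvalue_ge0.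
have afin : (\sum_(0 <= k <oo) a k < +oo)%E.
  apply: (@le_lt_trans _ _ (energy h)%:E); last exact: ltry.
  apply: lime_le; first by apply: is_cvg_nneseries => k _ _; exact: a0.
  apply: nearW => N; rewrite big_mkord /a sumEFin lee_fin.
  exact: dirichlet_bessel.
have /fine_cvgP[_ /cvgr0Pnorm_le tail0] := nneseries_tail_cvg afin (fun k _ => a0 k).
have e20 : 0 < e ^+ 2 by rewrite exprn_gt0.
have [N _ /(_ N (leqnn N))/= tailN] := tail0 _ e20.
exists N; rewrite /H10norm.
have -> : (\sum_(0 <= k <oo)
    (lambda k * `|L2dot Omega (fourier_remainder v N) (phi k)| ^+ 2)%:E =
    \sum_(N <= k <oo) a k)%E.
  rewrite (nneseries_split 0 N) ?add0n; last first.
    by move=> k _; rewrite lee_fin mulr_ge0 ?sqr_ge0 ?eigenvalue_ge0.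
  rewrite big_nat big1 ?add0e; last first.
    move=> k /= kN; rewrite fourier_remainder_coef// kN.
    by rewrite normr0 expr0n/= mulr0.
  congr (limn _); apply/funext => M; apply: eq_big_nat => k /andP[Nk _].
  by rewrite fourier_remainder_coef// ltnNge Nk/= real_normK ?num_real.
have tail_ge0 : (0 <= \sum_(N <= k <oo) a k)%E by apply: nneseries_ge0.
have tail_fin : (\sum_(N <= k <oo) a k)%E \is a fin_num.
  rewrite ge0_fin_numE//; apply: le_lt_trans afin.
  rewrite [leRHS](nneseries_split 0 N) ?add0n//.
  by rewrite leeDr// sume_ge0.
rewrite -(fineK tail_fin) in tail_ge0 *.
move: tailN tail_ge0; rewrite lee_fin => tN t0.
rewrite /= lee_fin -(ger0_norm (ltW e0)) -sqrtr_sqr ler_wsqrtr//.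
by apply: le_trans tN; exact: ler_norm.
Qed.

(** A functional that kills every eigenfunction takes the same value at v and at
    each Fourier remainder of v, and the remainders tend to 0 in norm. *)
Lemma Hm1_eq0_basis r v : Hm1 Omega lambda phi r -> (forall k, r (phi k) = 0) ->
  H10 Omega v -> r v = 0.
Proof.
move=> [rlin [C C0 rC]] r0 Hv.
have rrem N : r (fourier_remainder v N) = r v.
  elim: N => [|N IH]; first by rewrite fourier_remainder0.
  rewrite fourier_remainderS rlin; [|exact: eigenfunction_H10|exact: fourier_remainder_H10].
  by rewrite r0 mulr0 add0r.
apply/eqP; rewrite -normr_eq0; apply/eqP/le_anti; rewrite normr_ge0 andbT.
apply/ler_addgt0Pr => e e0; rewrite add0r.
have C10 : 0 < C + 1 by rewrite ltr_wpDl.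
(* Dividing by C + 1 rather than by C covers the zero bound. *)
have [N vN] := fourier_remainder_cvg Hv (divr_gt0 e0 C10).
have := rC _ (fourier_remainder_H10 N Hv); rewrite rrem.
move=> /le_trans/(_ (lee_wpmul2l _ vN)); rewrite lee_fin => /(_ C0).
rewrite -EFinM lee_fin => /le_trans; apply.
by rewrite mulrCA ger_pMr// ler_pdivrMr// mul1r lerDl.
Qed.

Lemma Hm1B r s : Hm1 Omega lambda phi r -> Hm1 Omega lambda phi s ->
  Hm1 Omega lambda phi (fun v => r v - s v).
Proof.
move=> [rlin [C C0 rC]] [slin [D D0 sD]]; split.
  by move=> a u v Hu Hv; rewrite rlin// slin//; ring.
exists (C + D); first exact: addr_ge0.
move=> u Hu; rewrite EFinD ge0_muleDl ?lee_fin//.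
apply: le_trans (leeD (rC u Hu) (sD u Hu)).
by rewrite -EFinD lee_fin ler_normB.
Qed.

Lemma Hm1_sum r (a : nat -> R) N : Hm1 Omega lambda phi r ->
  r (fun x => \sum_(k < N) a k * phi k x) = \sum_(k < N) a k * r (phi k).
Proof.
move=> [rlin _]; elim: N => [|N IH].
  have := rlin (-1) _ _ (eigenfunction_H10 0) (eigenfunction_H10 0).
  rewrite big_ord0 (_ : (fun x => -1 * phi 0 x + phi 0 x) =
    (fun x => \sum_(k < 0) a k * phi k x)); first by move=> ->; ring.
  by apply/funext => x; rewrite big_ord0; ring.
rewrite big_ord_recr/= addrC -IH -rlin; [|exact: eigenfunction_H10|].
  by congr r; apply/funext => x; rewrite big_ord_recr/= addrC.
by apply: H10_sum => // k; exact: eigenfunction_H10.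
Qed.

End eigenbasis.

(** * Independent coefficients are orthonormal *)

Section independent_coefficients.
Context d (Xi : measurableType d) (R : realType) (P : probability Xi R).

(** The variance of a centred variable is the integral of its square; that this
    integral is finite is what gives square integrability. *)
Lemma normalized_RV_square_integrable (X : {RV P >-> R}) : ('E_P[X] = 0)%E ->
  ('V_P[X] = 1)%E -> square_integrable P setT X /\ pairing P setT X X = 1.
Proof.
move=> EX0 VX1.
have X2 : (\int[P]_x (X x ^+ 2)%:E = 1)%E.
  rewrite -VX1 /variance unlock EX0/= unlock; apply: eq_integral => x _.
  by rewrite -[RHS]/((X x - 0) * (X x - 0))%:E subr0 expr2.
have sX : square_integrable P setT X.
  split; first exact: measurable_funPT.
  apply/integrableP; split.
    by apply/measurable_EFinP; apply: measurable_funX; exact: measurable_funPT.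
  rewrite (eq_integral (fun x => (X x ^+ 2)%:E)) ?X2 ?ltry// => x _.
  by rewrite gee0_abs// lee_fin sqr_ge0.
by split => //; move: X2; rewrite pairing_sqr// => -[].
Qed.

(** By the product rule, the joint law of X and Y agrees on rectangles with the
    product of their laws, hence everywhere. Transferring the integral of X Y
    to the plane and applying Fubini's theorem there separates the factors. *)
Lemma expectation_mul_independent (X Y : {RV P >-> R}) :
  (forall A B, measurable A -> measurable B ->
    P (X @^-1` A `&` Y @^-1` B) = (P (X @^-1` A) * P (Y @^-1` B))%E) ->
  square_integrable P setT X -> square_integrable P setT Y ->
  (\int[P]_x (X x * Y x)%:E = 'E_P[X] * 'E_P[Y])%E.
Proof.
move=> indep sX sY.
have s1 : square_integrable P setT (cst 1).
  split; first exact: measurable_cst.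
  by under eq_fun do rewrite expr1n; exact: finite_measure_integrable_cst.
have integrable_RV (Z : {RV P >-> R}) : square_integrable P setT Z ->
    P.-integrable setT (EFin \o Z).
  move=> sZ; apply: eq_integrable (integrable_mul _ sZ s1) => //.
  by move=> x _ /=; rewrite mulr1.
have iX := integrable_RV _ sX; have iY := integrable_RV _ sY.
have mXY : measurable_fun setT (fun x => (X x, Y x)).
  by apply: measurable_fun_pair; exact: measurable_funPT.
pose XY : {mfun Xi >-> (R * R)%type} :=
  HB.pack (fun x => (X x, Y x)) (isMeasurableFun.Build _ _ _ _ _ mXY).
pose f (z : R * R) : \bar R := (z.1 * z.2)%:E.
have mf : measurable_fun setT f.
  by apply/measurable_EFinP; apply: measurable_funM.
have ifXY : P.-integrable setT (f \o XY) := integrable_mul measurableT sX sY.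
have XYE A : measurable A ->
    (distribution P X \x distribution P Y)%E A = distribution P XY A.
  by apply: product_measure_unique => B C mB mC; rewrite -indep.
have prodi : (distribution P X \x distribution P Y)%E.-integrable setT f.
  apply/integrableP; split => //.
  rewrite (eq_measure_integral (distribution P XY)); last by move=> A /XYE.
  rewrite ge0_integral_distribution//; last exact: measurableT_comp.
  by have /integrableP[] := ifXY.
have idE (Z : {RV P >-> R}) : P.-integrable setT (EFin \o Z) ->
    (distribution P Z).-integrable setT (EFin : R -> \bar R).
  by move=> iZ; exact: integrable_pushforward.
have distE (Z : {RV P >-> R}) : P.-integrable setT (EFin \o Z) ->
    (\int[distribution P Z]_z z%:E = 'E_P[Z])%E.
  by move=> iZ; rewrite unlock integral_distribution.
rewrite -[LHS]/(\int[P]_x (f \o XY) x)%E -integral_distribution//.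
have -> : (\int[distribution P XY]_z f z =
    \int[distribution P X \x distribution P Y]_z f z)%E.
  by apply: eq_measure_integral => A /XYE.
have EYE : 'E_P[Y]%E = (fine 'E_P[Y]%E)%:E.
  by rewrite fineK// -(distE _ iY); exact: integrable_fin_num (idE _ iY).
rewrite -integral12_prod_meas1// -(distE _ iX) EYE -integralZr//; last exact: idE.
by apply: eq_integral => x _; rewrite -EYE -(distE _ iY) -integralZl//; exact: idE.
Qed.

Lemma independent_pair (w : nat -> {RV P >-> R}) j k A B : independent w ->
  j != k -> measurable A -> measurable B ->
  P (w j @^-1` A `&` w k @^-1` B) = (P (w j @^-1` A) * P (w k @^-1` B))%E.
Proof.
move=> indep jk mA mB; pose C i := if i == j then A else B.
have mC i : measurable (C i) by rewrite /C; case: ifP.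
have := indep [fset j; k]%fset C mC.
rewrite big_fsetU1 ?inE//= big_seq_fset1 /C eqxx eq_sym (negPf jk) => <-.
congr (P _); apply/seteqP; split => [x [Ax Bx] i|x xC].
  by rewrite /= !inE => /orP[/eqP ->|/eqP ->]; rewrite ?eqxx// eq_sym (negPf jk).
have xj := xC j; have xk := xC k; rewrite /= !inE !eqxx/= orbT in xj xk.
split; first exact: xj.
by move: (xk isT); rewrite eq_sym (negPf jk).
Qed.

(** For distinct indices the mean of the product is the product of the means,
    which are zero; on the diagonal it is the variance. *)
Lemma independent_orthonormal (w : nat -> {RV P >-> R}) : independent w ->
  (forall k, 'E_P[w k] = 0)%E -> (forall k, 'V_P[w k] = 1)%E ->
  forall j k, pairing P setT (w j) (w k) = (j == k)%:R.
Proof.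
move=> indep E0 V1 j k.
have sw i := (normalized_RV_square_integrable (E0 i) (V1 i)).1.
have [->|jk] := eqVneq j k; first exact: (normalized_RV_square_integrable (E0 k) (V1 k)).2.
rewrite /pairing /Rintegral expectation_mul_independent// ?E0 ?mule0//.
by move=> A B; exact: independent_pair.
Qed.

End independent_coefficients.

(** The partial sums are nondecreasing, so each term is bounded by the limit. *)
Lemma lim_sum_sqr_eq0 (R : realType) (a : nat -> R) :
  sqrte (limn (fun N => (\sum_(k < N) a k ^+ 2)%:E)) = 0%E ->
  forall k, a k = 0.
Proof.
set l := limn _ => l0 k.
have nd : nondecreasing_seq (fun N => (\sum_(k < N) a k ^+ 2)%:E).
  apply/nondecreasing_seqP => N; rewrite lee_fin big_ord_recr/= lerDl.
  exact: sqr_ge0.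
have al : ((a k ^+ 2)%:E <= l)%E.
  apply: lime_ge; first exact: ereal_nondecreasing_is_cvgn.
  exists k.+1 => // N /= kN; apply: le_trans (nd _ _ kN).
  by rewrite lee_fin big_ord_recr/= lerDr sumr_ge0// => i _; exact: sqr_ge0.
have : (l <= 0)%E.
  move: l0; case: (l) => [s|//|//] /= [/eqP]; rewrite sqrtr_eq0 lee_fin//.
move=> /(le_trans al); rewrite lee_fin => a0.
by apply/eqP; rewrite -sqrf_eq0; apply/eqP/le_anti; rewrite a0 sqr_ge0.
Qed.

(** * The stochastic norm of a functional *)

Section random_functional.
Context (R : realType) (n : nat) (Omega : set 'rV[R]_n).
Hypotheses (Omega_bounded : bounded_set Omega) (Omega_open : open Omega).
Context (lambda : nat -> R) (phi : nat -> 'rV[R]_n -> R).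
Hypothesis eigen : dirichlet_eigenbasis Omega lambda phi.
Context d (Xi : measurableType d) (P : probability Xi R).
Context (w : nat -> {RV P >-> R}) (w_indep : independent w).
Context (w_mean : forall k, ('E_P[w k] = 0)%E) (w_var : forall k, ('V_P[w k] = 1)%E).
Context (tau : R) (tau_gt0 : 0 < tau).

(** By linearity, the value of r at the random partial sum is the sum of the
    variables w_k with weights tau (1 + lambda_k)^(-1/2) r(phi_k), and the w_k
    are orthonormal. *)
Lemma expectation_random_map r N : Hm1 Omega lambda phi r ->
  ('E_P[fun xi => (`|r (random_map lambda phi tau w N xi)| ^+ 2)%R] =
  (\sum_(k < N) (tau * (1 + lambda k) `^ (- 2^-1) * r (phi k)) ^+ 2)%:E)%E.
Proof.
move=> Hr; pose a k := tau * (1 + lambda k) `^ (- 2^-1) * r (phi k).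
have sw k := (normalized_RV_square_integrable (w_mean k) (w_var k)).1.
rewrite -(parseval_sum measurableT a N sw (independent_orthonormal w_indep w_mean w_var)).
rewrite -pairing_sqr//; last exact: (square_integrable_sum measurableT a N sw).
rewrite unlock; apply: eq_integral => xi _; rewrite real_normK ?num_real//.
rewrite (_ : random_map _ _ _ _ _ _ = (fun x =>
    \sum_(k < N) (tau * (1 + lambda k) `^ (- 2^-1) * w k xi) * phi k x)); last first.
  apply/funext => x; rewrite /random_map mulr_sumr; apply: eq_bigr => k _.
  by rewrite !mulrA.
rewrite (Hm1_sum Omega_bounded Omega_open eigen
  (fun k => tau * (1 + lambda k) `^ (- 2^-1) * w k xi) N Hr).
by congr (_ ^+ 2)%:E; apply: eq_bigr => k _; rewrite /a mulrAC.
Qed.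

(** The weights tau (1 + lambda_k)^(-1/2) are positive, so the sum of squares
    vanishes exactly when r kills every eigenfunction. *)
Lemma stochastic_norm_eq0 r : Hm1 Omega lambda phi r ->
  stochastic_norm lambda phi tau w r = 0%E <-> forall v, H10 Omega v -> r v = 0.
Proof.
move=> Hr; rewrite /stochastic_norm.
under eq_fun do rewrite expectation_random_map//.
pose a k := tau * (1 + lambda k) `^ (- 2^-1) * r (phi k).
split => [/(@lim_sum_sqr_eq0 _ a) a0 v|r0].
  apply: (Hm1_eq0_basis Omega_bounded Omega_open eigen Hr) => k.
  have /eqP := a0 k; rewrite mulf_eq0 => /orP[|/eqP//].
  by rewrite gt_eqF// mulr_gt0// powR_gt0// ltr_wpDr// (eigenvalue_ge0 eigen).
rewrite (_ : (fun N => _) = cst 0%E) ?lim_cst ?/= ?sqrtr0//; apply/funext => N.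
rewrite big1// => k _; rewrite r0 ?mulr0 ?expr0n//; exact: (eigenfunction_H10 eigen).
Qed.

End random_functional.

Theorem corollary3p5 (R : realType) (n : nat) (n_gt0 : (0 < n)%N)
  (Omega : set 'rV[R]_n) (Omega_dom : lipschitz_domain Omega)
  (lambda : nat -> R) (phi : nat -> 'rV[R]_n -> R)
  (phi_eigen : dirichlet_eigenbasis Omega lambda phi)
  (L : ('rV[R]_n -> R) -> ('rV[R]_n -> R) -> R)
  (L_elliptic : second_order_elliptic Omega L)
  (L_Hm1 : forall u, H10 Omega u -> Hm1 Omega lambda phi (L u))
  (f : ('rV[R]_n -> R) -> R) (f_Hm1 : Hm1 Omega lambda phi f)
  (weak_unique : unique_weak_solution Omega L f)
  (d : measure_display) (Xi : measurableType d) (P : probability Xi R)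
  (w : nat -> {RV P >-> R}) (w_indep : independent w)
  (w_mean : forall k, ('E_P[w k] = 0)%E) (w_var : forall k, ('V_P[w k] = 1)%E)
  (tau : R) (tau_gt0 : 0 < tau)
  (u : 'rV[R]_n -> R) (u_H10 : H10 Omega u) :
  weak_solution Omega L f u <->
  stochastically_weak_solution Omega lambda phi tau w L f u.
Proof.
have [bOmega oOmega _ _] := Omega_dom.
have residual_Hm1 := Hm1B (L_Hm1 u u_H10) f_Hm1.
have normE := stochastic_norm_eq0 bOmega oOmega phi_eigen w_indep
  w_mean w_var tau_gt0 residual_Hm1.
by split=> -[Hu /normE].
Qed.
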